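(* Let $n\ge2$, let $\lambda=(\lambda_1,\lambda_2,\lambda_3,\dots,\lambda_n)$ be a partition of length at most $n$ such that $\lambda_1=\lambda_2$, let $\lambda^{(0)}=(\lambda_2,\dots,\lambda_n)$ be its bottom partition, and let $0<a<b$. Then the Chebyshev-Bernstein basis of $\mathcal{E}_\lambda(n)$ over $[a,b]$ satisfies, for $k=0,\dots,n$, $$\frac{dB^n_{k,\lambda}(t)}{dt}=\frac{n}{(b-a)\binom{\lambda}{\lambda^{(0)}}_{n-1}}\left(R_\lambda(k-1,n)\,B^{n-1}_{k-1,\lambda^{(0)}}(t)-R_\lambda(k,n)\,B^{n-1}_{k,\lambda^{(0)}}(t)\right),$$ where $(B^{n-1}_{0,\lambda^{(0)}},\dots,B^{n-1}_{n-1,\lambda^{(0)}})$ is the Chebyshev-Bernstein basis of $\mathcal{E}_{\lambda^{(0)}}(n-1)$ over $[a,b]$, with the convention $B^{n-1}_{-1,\lambda^{(0)}}\equiv B^{n-1}_{n,\lambda^{(0)}}\equiv0$ (so the corresponding terms are zero).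
   Context: Partitions and Schur functions: a partition of length at most $n$ is a sequence of integers $\lambda_1\ge\dots\ge\lambda_n\ge0$; partitions differing only by trailing zeros are identified. For a partition $\nu$ of length at most $m$, $S_\nu(u_1,\dots,u_m)=\det(u_i^{\nu_j+m-j})_{1\le i,j\le m}/\det(u_i^{m-j})_{1\le i,j\le m}$ is the Schur polynomial (evaluated also at coinciding arguments). The notation $S_\nu(x^p,y^q)$ means that $x$ is repeated $p$ times and $y$ is repeated $q$ times. $f_\nu(m)=S_\nu(1^m)$ is the number of semi-standard Young tableaux of shape $\nu$ with entries at most $m$; $f_\emptyset(m)=1$. Müntz space: $\mathcal{E}_\lambda(n)$ is the span on $]0,\infty[$ of $1,t^{\lambda_1-\lambda_2+1},t^{\lambda_1-\lambda_3+2},\dots,t^{\lambda_1-\lambda_n+(n-1)},t^{\lambda_1+n}$. Chebyshev-Bernstein basis $(B^n_{0,\lambda},\dots,B^n_{n,\lambda})$ of $\mathcal{E}_\lambda(n)$ over $[a,b]\subset\,]0,\infty[$: the unique basis of $\mathcal{E}_\lambda(n)$ with $\sum_{k}B^n_{k,\lambda}=1$ such that, for each $k$, $B^n_{k,\lambda}$ vanishes $k$ times at $a$ and $n-k$ times at $b$ (counting multiplicity). Factors: with $\eta=(\lambda_3,\dots,\lambda_n)$, $$R_\lambda(k,n)=\frac{S_{\lambda^{(0)}}(a^{n-k-1},b^{k+1})\,S_{\lambda^{(0)}}(a^{n-k},b^k)}{S_\lambda(a^{n-k},b^{k+1})\,S_\eta(a^{n-k-1},b^k)},\qquad \binom{\lambda}{\lambda^{(0)}}_{\!n-1}=\frac{f_{\lambda^{(0)}}(n)^2}{f_\lambda(n+1)\,f_\eta(n-1)}.$$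 *)

(* Defs.v *)
From HB Require Import structures.
From mathcomp Require Import all_boot all_order all_algebra.
From mathcomp Require Import all_classical all_reals all_analysis.
(* the notations of mpoly clash with those of mathcomp-analysis *)
From mathcomp Require mpoly.
Import (canonicals, coercions) mpoly.
Set Implicit Arguments.
Unset Strict Implicit.
Unset Printing Implicit Defensive.
Import Order.TTheory GRing.Theory Num.Theory.
Import numFieldNormedType.Exports.
Local Open Scope classical_set_scope.
Local Open Scope ring_scope.

(* The part lambda_i is nth 0 la i.-1, so that parts beyond the size are 0 and
   trailing zeros are immaterial. *)
Definition is_partition (n : nat) (la : seq nat) : Prop :=
  (size la <= n)%N /\ sorted geq la.

(* (lambda_2, lambda_3, ...); iterating it twice gives (lambda_3, ...) *)
Definition bottom_partition (la : seq nat) : seq nat := behead la.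

Section Schur.
Variables (R : realType).

(* det (u_i ^ (nu_j + m - j)), 1 <= i, j <= m, in the indeterminates u_i;
   the indices are shifted to start at 0 *)
Definition alternant (m : nat) (nu : seq nat) : mpoly.mpoly m R :=
  \det (\matrix_(i < m, j < m)
    (mpoly.mpolyX R (mpoly.mnm1 i) ^+ (nth 0%N nu j + (m - j.+1)))).

(* The quotient of the alternant by the Vandermonde determinant
   alternant m [::], taken in the integral domain R[u_1, ..., u_m], where the
   division is exact (when size nu <= m); being a polynomial, it can be
   evaluated at coinciding arguments. *)
Definition schur_poly (m : nat) (nu : seq nat) : mpoly.mpoly m R :=
  xget 0 [set p | p * alternant m [::] = alternant m nu].

Definition schur (m : nat) (nu : seq nat) (u : 'I_m -> R) : R :=
  mpoly.meval u (schur_poly m nu).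

(* S_nu (x^p, y^q) *)
Definition schur2 (nu : seq nat) (x : R) (p : nat) (y : R) (q : nat) : R :=
  schur nu (fun i : 'I_(p + q) => if (i < p)%N then x else y).

Definition fSchur (nu : seq nat) (m : nat) : R := schur nu (fun _ : 'I_m => 1).

(* R_lambda (k, n); meaningful for 0 <= k <= n - 1 *)
Definition Rfactor (la : seq nat) (a b : R) (k n : nat) : R :=
  (schur2 (bottom_partition la) a (n - k - 1) b k.+1 *
   schur2 (bottom_partition la) a (n - k) b k)
  / (schur2 la a (n - k) b k.+1 *
     schur2 (bottom_partition (bottom_partition la)) a (n - k - 1) b k).

(* the generalized binomial (lambda over lambda^(0))_(n - 1) *)
Definition gbinom (la : seq nat) (n : nat) : R :=
  fSchur (bottom_partition la) n ^+ 2 /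
  (fSchur la n.+1 * fSchur (bottom_partition (bottom_partition la)) n.-1).

End Schur.

Section ChebyshevBernstein.
Variables (R : realType).

(* lambda_1 - lambda_(i+1) + i, for 0 <= i <= n; since lambda_(n+1) = 0, this is
   0 for i = 0 and lambda_1 + n for i = n. The subtraction is never truncated
   when la is a partition. *)
Definition muntz_exp (la : seq nat) (i : nat) : nat :=
  (nth 0 la 0 - nth 0 la i + i)%N.

(* Functions on ]0, +oo[ are represented by functions on R of which only the
   values at t > 0 are relevant. *)
Definition muntz (n : nat) (la : seq nat) : set (R -> R) :=
  [set f | exists c : 'I_n.+1 -> R, forall t, 0 < t ->
     f t = \sum_(i < n.+1) c i * t ^+ muntz_exp la i].

(* Only the members B 0, ..., B n of the family are relevant; linear
   independence is meant on ]0, +oo[. *)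
Definition is_basis (n : nat) (E : set (R -> R)) (B : nat -> R -> R) : Prop :=
  [/\ forall k, (k <= n)%N -> E (B k),
      forall f, E f -> exists c : 'I_n.+1 -> R, forall t, 0 < t ->
        f t = \sum_(i < n.+1) c i * B i t
    & forall c : 'I_n.+1 -> R,
        (forall t, 0 < t -> \sum_(i < n.+1) c i * B i t = 0) ->
        forall i, c i = 0].

(* x is a zero of multiplicity at least k; a nonzero element of muntz n la has
   at most n zeros in ]0, +oo[ counted with multiplicity, so that in the
   definition below the multiplicities are in fact exactly k and n - k *)
Definition vanishes (f : R -> R) (x : R) (k : nat) : Prop :=
  forall j, (j < k)%N -> derive1n j f x = 0.

Definition is_CB_basis (n : nat) (la : seq nat) (a b : R) (B : nat -> R -> R)
    : Prop :=
  [/\ is_basis n (muntz n la) B,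
      forall t, 0 < t -> \sum_(k < n.+1) B k t = 1
    & forall k, (k <= n)%N ->
        vanishes (B k) a k /\ vanishes (B k) b (n - k)].

End ChebyshevBernstein.

(* Main.v *)
Require Import Defs.
From HB Require Import structures.
From mathcomp Require Import all_boot all_order all_algebra perm.
From mathcomp Require Import all_classical all_reals all_analysis.
From mathcomp Require Import ring zify.
From mathcomp Require mpoly.
Import (canonicals, coercions) mpoly.
Set Implicit Arguments.
Unset Strict Implicit.
Unset Printing Implicit Defensive.
Import Order.TTheory GRing.Theory Num.Theory.
Import numFieldNormedType.Exports.
Local Open Scope ring_scope.

(** Write theta = t d/dt and let T_k = B_k + ... + B_n be the tails of the
    basis.  T_k vanishes k times at a, and T_k - 1, being minus the sum of the
    B_j with j < k, vanishes n - k + 1 times at b.  When lambda_1 = lambda_2 the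
    exponents of the Muntz space are 0 and the successors of those of the space
    of the bottom partition, so T_k' lies in the latter space; it vanishes k - 1
    times at a and n - k times at b, hence T_(r+1)' = d_r B'_r for some scalar
    d_r ([deriv_tail]).  As B_k = T_k - T_(k+1), this already is the formula,
    except for the value of d_r.

    Applying theta^r at a gives a d_r tau'_r = tau_(r+1), where
    tau_k = theta^k B_k (a), and tau'_r is the same number for the second basis.
    The vanishing conditions and the normalisation of T_k form a linear system
    on its coefficients in the powers t^(e_j), whose rows are (e_j^i a^(e_j))_j
    and (e_j^i b^(e_j))_j because theta^i t^e = e^i t^e.  Cramer's rule
    expresses tau_k as a quotient of two determinants of this kind, the confluent
    alternants [confluent] ([euler_at_CB_poly]).  One of them belongs to the
    given partition and the other to its bottom partition, so that d_r involves
    four of them, for the partition, its second bottom partition and, twice, its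
    bottom partition.

    A confluent alternant is a Schur value up to elementary factors.  Expanding
    powers in the Newton basis attached to points u_0, u_1, ... factors the
    alternant as a triangular determinant, which carries the Vandermonde factors,
    times a determinant of divided differences ([det_functionals]).  The latter
    is, up to sign, the Schur polynomial for indeterminate points ([schurE]);
    since it makes sense for repeated points as well, it also is the Schur value
    for the confluent alternant ([schur2_confluent]).  The exponents of a Muntz
    space are lambda_1 + n minus those of the Schur alternant, and reversing
    exponents exchanges the roles of a and b ([confluent_muntz]).  In the ratio
    d_r all powers of a and b cancel and the Vandermonde factors leave
    1 / (b - a) ([deriv_tail_coef], [confluent_vandermonde_rec]).  The remaining
    constant is a quotient of products of exponents; the same column expansion at
    a = b = 1 identifies it with the generalized binomial ([fSchur_behead],
    [gbinomE]).

    The alternants in denominators do not vanish because Chebyshev-Bernstein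
    bases exist: at either end point the basis is triangular with respect to
    the order of vanishing, so an element of the space with n + 1 zeros at the
    end points has no nonzero coordinate ([CB_poly_confluent_neq0]). *)

(** * Newton expansions of powers *)

Section NewtonExpansion.
Variable A : comNzRingType.
Implicit Types (u : nat -> A) (p : {poly A}).

(** The divided difference of X^N at u_0, ..., u_i, that is, the complete
    homogeneous polynomial of degree N - i in these points.  The recursion on N,
    obtained by multiplying a Newton expansion by X, uses ring operations only,
    so that points may coincide and ring morphisms commute with it. *)
Fixpoint newton_coef u N i : A :=
  if N is N'.+1 then
    u i * newton_coef u N' i + (if i is i'.+1 then newton_coef u N' i' else 0)
  else (i == 0)%:R.

Definition newton_poly u i : {poly A} := \prod_(l < i) ('X - (u l)%:P).

Lemma newton_coef_gt u N i : (N < i)%N -> newton_coef u N i = 0.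
Proof.
elim: N i => [|N IH] [|i] //= ltNi.
by rewrite !IH ?mulr0 ?addr0 // ltnW.
Qed.

Lemma newton_coef_diag u N : newton_coef u N N = 1.
Proof. by elim: N => //= N ->; rewrite newton_coef_gt // mulr0 add0r. Qed.

Lemma eq_newton_coef u v N i :
  (forall l, (l <= i)%N -> u l = v l) -> newton_coef u N i = newton_coef v N i.
Proof.
elim: N i => //= N IH i uv; rewrite uv // IH //.
by case: i uv => // i uv; rewrite (IH i) // => l li; rewrite uv // ltnW.
Qed.

Lemma newton_polyS u i :
  newton_poly u i.+1 = newton_poly u i * ('X - (u i)%:P).
Proof. by rewrite /newton_poly big_ord_recr. Qed.

Lemma Xn_newton u N M : (N < M)%N ->
  'X^N = \sum_(i < M) newton_coef u N i *: newton_poly u i.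
Proof.
elim: N M => [|N IH] [|M] // ltNM.
  rewrite big_ord_recl big1 => [|i _]; last by rewrite /= scale0r.
  by rewrite /newton_poly big_ord0 /= scale1r addr0.
rewrite exprS (IH M) // mulr_sumr /=.
under [RHS]eq_bigr do rewrite scalerDl.
rewrite big_split /= big_ord_recr /= newton_coef_gt // mulr0 scale0r addr0.
rewrite [X in _ + X]big_ord_recl /= scale0r add0r -big_split /=.
apply: eq_bigr => i _; rewrite /bump /= add1n newton_polyS -scalerAr.
rewrite mulrBr [_ * (u i)%:P]mulrC mul_polyC scalerBr scalerA (mulrC _ (u i)).
by rewrite addrC subrK mulrC.
Qed.

Lemma det_newton_coef_incr u m :
  \det (\matrix_(i < m, j < m) newton_coef u j i) = 1.
Proof.
rewrite -det_tr det_trig; last first.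
  by apply/is_trig_mxP => i j ltij; rewrite !mxE newton_coef_gt.
by rewrite big1 // => i _; rewrite !mxE newton_coef_diag.
Qed.

(** The sign of the order reversal of m columns: exponents decrease in the
    alternants that define Schur polynomials. *)
Definition rev_sign m : A := (-1) ^+ perm (@rev_ord_inj m).

Lemma rev_sign_sqr m : rev_sign m * rev_sign m = 1.
Proof. by rewrite -expr2 /rev_sign sqrr_sign. Qed.

Lemma det_newton_coef_decr u m :
  \det (\matrix_(i < m, j < m) newton_coef u (m - j.+1) i) = rev_sign m.
Proof.
pose M := \matrix_(i < m, j < m) newton_coef u j i.
have -> : (\matrix_(i < m, j < m) newton_coef u (m - j.+1) i) =
    col_perm (perm (@rev_ord_inj m)) M.
  by apply/matrixP => i j; rewrite !mxE permE.
by rewrite col_permE det_mulmx det_newton_coef_incr mul1r det_perm odd_permV.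
Qed.

(** Newton expansion turns a matrix of functionals evaluated on powers into a
    product, whose first factor is lower triangular as soon as the i-th
    functional kills the Newton polynomials of index larger than i.  Both
    evaluations at the points and iterated derivatives at repeated points have
    this property, which is how ordinary and confluent alternants get the same
    second factor. *)
Lemma det_functionals m (phi : nat -> {scalar {poly A}}) u (e : nat -> nat) :
  (forall i l, (i < m)%N -> (i < l)%N -> phi i (newton_poly u l) = 0) ->
  \det (\matrix_(i < m, j < m) phi i 'X^(e j)) =
  (\prod_(i < m) phi i (newton_poly u i)) *
  \det (\matrix_(i < m, j < m) newton_coef u (e j) i).
Proof.
move=> phi0.
pose K := \matrix_(i < m, l < m) phi i (newton_poly u l).
have -> : \prod_(i < m) phi i (newton_poly u i) = \det K.
  rewrite det_trig; first by apply: eq_bigr => i _; rewrite mxE.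
  by apply/is_trig_mxP => i l ltil; rewrite mxE phi0.
rewrite -det_mulmx; congr (\det _); apply/matrixP => i j; rewrite !mxE.
rewrite (@Xn_newton u _ (maxn (e j).+1 m)) ?leq_maxl // linear_sum /=.
rewrite -(big_mkord xpredT (fun l =>
  phi i (newton_coef u (e j) l *: newton_poly u l))).
rewrite (big_cat_nat (leq0n m)) ?leq_maxr //=.
rewrite [X in _ + X]big_nat_cond [X in _ + X]big1; last first.
  move=> l; rewrite andbT => /andP[leml _].
  by rewrite linearZ /= phi0 ?mulr0 // (leq_trans (ltn_ord i)).
rewrite addr0 big_mkord; apply: eq_bigr => l _.
by rewrite linearZ /= !mxE mulrC.
Qed.

End NewtonExpansion.

Lemma rmorph_newton_coef (A A' : comNzRingType) (f : {rmorphism A -> A'})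
    (u : nat -> A) N i :
  f (newton_coef u N i) = newton_coef (f \o u) N i.
Proof.
elim: N i => [|N IH] i /=; first by rewrite rmorph_nat.
by rewrite rmorphD rmorphM IH; case: i => [|i]; rewrite ?IH ?rmorph0.
Qed.

(** * Schur polynomials as determinants of divided differences *)

Section Schur.
Variables (R : realType) (m : nat).

(** The indeterminates as a sequence, extended by 0 so that they can serve as
    interpolation points. *)
Definition mvar (l : nat) : mpoly.mpoly m R :=
  if insub l is Some i then mpoly.mpolyX R (mpoly.mnm1 i) else 0.

Lemma mvar_ord (i : 'I_m) : mvar i = mpoly.mpolyX R (mpoly.mnm1 i).
Proof. by rewrite /mvar valK. Qed.

Definition schur_exp (nu : seq nat) (j : nat) : nat := (nth 0 nu j + (m - j.+1))%N.

Lemma alternantE (nu : seq nat) :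
  alternant R m nu =
  \prod_(i < m) \prod_(l < i) (mvar i - mvar l) *
  \det (\matrix_(i < m, j < m) newton_coef mvar (schur_exp nu j) i).
Proof.
have -> : \prod_(i < m) \prod_(l < i) (mvar i - mvar l) =
    \prod_(i < m) horner_eval (mvar i) (newton_poly mvar i).
  apply: eq_bigr => i _; rewrite /newton_poly rmorph_prod /=.
  by apply: eq_bigr => l _; rewrite /horner_eval !hornerE.
rewrite -(@det_functionals _ m (fun i => horner_eval (mvar i))).
  congr (\det _); apply/matrixP => i j.
  by rewrite !mxE /= /horner_eval hornerXn mvar_ord.
move=> i l _ ltil; rewrite /newton_poly rmorph_prod /=.
rewrite (bigD1 (Ordinal ltil)) //= {1}/horner_eval.
by rewrite !hornerE subrr mul0r.
Qed.

Lemma mvar_neq (i l : nat) : (i < m)%N -> (l < i)%N -> mvar i - mvar l != 0.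
Proof.
move=> ltim ltli; have ltlm := ltn_trans ltli ltim.
rewrite (mvar_ord (Ordinal ltim)) (mvar_ord (Ordinal ltlm)).
apply/eqP => /(congr1 (mpoly.meval (fun k : 'I_m => (k == i :> nat)%:R : R))).
rewrite mpoly.mevalB mpoly.meval0 !mpoly.mevalXU eqxx /=.
by rewrite (ltn_eqF ltli) subr0 => /eqP; rewrite oner_eq0.
Qed.

(** The double product of differences in [alternantE] is common to all
    partitions, and for the empty one the determinant of divided differences is
    a sign; the quotient of the alternants is therefore the determinant of
    divided differences up to that sign. *)
Lemma schur_polyE (nu : seq nat) :
  schur_poly R m nu =
  rev_sign _ m * \det (\matrix_(i < m, j < m) newton_coef mvar (schur_exp nu j) i).
Proof.
pose V := \prod_(i < m) \prod_(l < i) (mvar i - mvar l).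
have V0 : V != 0.
  apply/prodf_neq0 => i _; apply/prodf_neq0 => l _.
  exact: mvar_neq (ltn_ord i) (ltn_ord l).
have alt0 : alternant R m [::] = rev_sign _ m * V.
  rewrite alternantE mulrC -(det_newton_coef_decr mvar m).
  have -> : (\matrix_(i < m, j < m) newton_coef mvar (m - j.+1) i) =
      \matrix_(i < m, j < m) newton_coef mvar (schur_exp [::] j) i.
    by apply/matrixP => i j; rewrite !mxE /schur_exp nth_nil.
  by [].
have P : rev_sign _ m *
    \det (\matrix_(i < m, j < m) newton_coef mvar (schur_exp nu j) i) *
    alternant R m [::] = alternant R m nu.
  by rewrite alt0 [in RHS]alternantE mulrACA rev_sign_sqr mul1r mulrC.
apply: (@xget_unique _ _ _ _ P) => p /= Hp.
have alt_neq0 : alternant R m [::] != 0 by rewrite alt0 mulf_neq0 // signr_eq0.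
by apply: (mulIf alt_neq0); rewrite P.
Qed.

Lemma schurE (nu : seq nat) (v : nat -> R) :
  schur nu (fun i : 'I_m => v i) =
  rev_sign _ m * \det (\matrix_(i < m, j < m) newton_coef v (schur_exp nu j) i).
Proof.
rewrite /schur schur_polyE rmorphM -det_map_mx /rev_sign rmorph_sign.
congr (_ * \det _); apply/matrixP => i j; rewrite !mxE rmorph_newton_coef.
apply: eq_newton_coef => l lei /=.
rewrite (_ : l = Ordinal (leq_ltn_trans lei (ltn_ord i))) // mvar_ord.
by rewrite mpoly.mevalXU.
Qed.

End Schur.

(** * The operator t d/dt on polynomials *)

Section Euler.
Variable A : comNzRingType.
Implicit Types (x : A) (p : {poly A}).

(** The operator t d/dt is preferred to d/dt because powers are its
    eigenvectors: the rows of the determinants below are then pure powers of the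
    exponents. *)
Definition euler p : {poly A} := 'X * p^`().

Definition euler_at i x p : A := (iter i euler p).[x].

Fact euler_iter_linear i c p q :
  iter i euler (c *: p + q) = c *: iter i euler p + iter i euler q.
Proof.
elim: i => //= i ->.
by rewrite /euler derivD derivZ mulrDr -scalerAr.
Qed.

Fact euler_at_is_linear i x : linear_for *%R (euler_at i x).
Proof. by move=> c p q; rewrite /euler_at euler_iter_linear hornerD hornerZ. Qed.

HB.instance Definition _ i x :=
  GRing.isLinear.Build A {poly A} A *%R (euler_at i x) (euler_at_is_linear i x).

Lemma euler_atS i x p : euler_at i.+1 x p = euler_at i x (euler p).
Proof. by rewrite /euler_at iterSr. Qed.

Lemma eulerXn N : euler 'X^N = N%:R *: 'X^N.
Proof.
rewrite /euler derivXn; case: N => [|N] /=; first by rewrite mulr0n mulr0 scale0r.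
by rewrite mulrnAr -exprS scaler_nat.
Qed.

Lemma euler_atXn i x N : euler_at i x 'X^N = N%:R ^+ i * x ^+ N.
Proof.
elim: i => [|i IH]; first by rewrite /euler_at /= hornerXn mul1r.
by rewrite euler_atS eulerXn linearZ /= IH mulrA -exprS.
Qed.

Lemma euler_factor x l p :
  euler (('X - x%:P) ^+ l.+1 * p) =
  ('X - x%:P) ^+ l * ('X * (p *+ l.+1 + ('X - x%:P) * p^`())).
Proof.
rewrite /euler derivM deriv_exp derivXsubC mul1r /=.
by rewrite -mulr_natl -[p *+ _]mulr_natl exprS; ring.
Qed.

Lemma euler_at_lt i x l p : (i < l)%N -> euler_at i x (('X - x%:P) ^+ l * p) = 0.
Proof.
elim: i l p => [|i IH] [|l] p // ltil.
  by rewrite /euler_at /= exprS -mulrA hornerM hornerXsubC subrr mul0r.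
by rewrite euler_atS euler_factor IH.
Qed.

Lemma euler_at_eq x l p :
  euler_at l x (('X - x%:P) ^+ l * p) = l`!%:R * x ^+ l * p.[x].
Proof.
elim: l p => [|l IH] p; first by rewrite /euler_at /= !mul1r.
rewrite euler_atS euler_factor IH hornerM hornerX hornerD hornerM hornerXsubC.
by rewrite subrr mul0r addr0 hornerMn -mulr_natl factS natrM exprS; ring.
Qed.

End Euler.

Section EulerRoots.
Variable R : comNzRingType.
Implicit Types (x : R) (p : {poly R}).

Lemma derivn_euler p j : (euler p)^`(j) = 'X * p^`(j.+1) + p^`(j) *+ j.
Proof.
elim: j => [|j IH]; first by rewrite mulr0n addr0 derivn1.
rewrite derivnS IH derivD derivM derivX mul1r derivMn -!derivnS.
by rewrite mulrSr; ring.
Qed.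

Lemma euler_at_derivn x k p :
  (forall j, (j < k)%N -> p^`(j).[x] = 0) ->
  forall i, (i < k)%N -> euler_at i x p = 0.
Proof.
move=> pk i; elim: i p k pk => [|i IH] p k pk ltik; first exact: (pk 0%N).
rewrite euler_atS; apply: (IH _ k.-1); last by lia.
move=> j ltj; rewrite derivn_euler hornerD hornerM hornerMn.
by rewrite !pk ?mulr0 ?mul0rn ?addr0 //; lia.
Qed.

Lemma euler_at_mulX x i p :
  (forall j, (j < i)%N -> euler_at j x p = 0) ->
  euler_at i x ('X * p) = x * euler_at i x p.
Proof.
elim: i p => [|i IH] p pi; first by rewrite /euler_at /= hornerM hornerX.
have -> : euler_at i.+1 x ('X * p) =
    euler_at i x ('X * p) + euler_at i x ('X * euler p).
  rewrite euler_atS -linearD; congr euler_at.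
  by rewrite /euler derivM derivX; ring.
rewrite (IH p) => [|j ltji]; last by rewrite pi // ltnW.
rewrite (IH (euler p)) => [|j ltji]; last by rewrite -euler_atS pi.
by rewrite (pi i) // mulr0 add0r -euler_atS.
Qed.

End EulerRoots.

Lemma euler_at_mulX_eq0 (R : fieldType) (x : R) k (p : {poly R}) : x != 0 ->
  (forall i, (i < k)%N -> euler_at i x ('X * p) = 0) ->
  forall i, (i < k)%N -> euler_at i x p = 0.
Proof.
move=> x0 Xp0; elim/ltn_ind => i IH ltik; apply/eqP.
have := Xp0 i ltik; rewrite euler_at_mulX => [/eqP|j ltji]; last first.
  by rewrite IH // (ltn_trans ltji).
by rewrite mulf_eq0 (negPf x0).
Qed.

(** * Confluent alternants at two points *)

Section Confluent.
Variable A : comNzRingType.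
Implicit Types (x y : A) (e : nat -> nat).

Definition node p x y (i : nat) : A := if (i < p)%N then x else y.

(** The rank of the i-th point among the points equal to it: the order of the
    iterate of t d/dt to be taken there. *)
Definition local_index (p i : nat) : nat := if (i < p)%N then i else (i - p)%N.

(** The confluent form of det (u_i^(e_j)) for the points x (p times) and y: the
    row of the powers of a point is followed by its images under t d/dt. *)
Definition confluent m p x y e : A :=
  \det (\matrix_(i < m, j < m)
     ((e j)%:R ^+ local_index p i * node p x y i ^+ e j)).

(** The confluent alternant of the exponents 0, 1, ..., m - 1. *)
Definition confluent_vandermonde m p x y : A :=
  \prod_(i < m) ((local_index p i)`!%:R * node p x y i ^+ local_index p i *
                 (if (i < p)%N then 1 else (y - x) ^+ p)).

Lemma newton_poly_node p x y l :
  newton_poly (node p x y) l =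
  ('X - x%:P) ^+ minn l p * ('X - y%:P) ^+ (l - p).
Proof.
elim: l => [|l IH]; first by rewrite /newton_poly big_ord0 min0n mul1r.
rewrite newton_polyS IH /node; case: ltnP => [ltlp|lepl].
  have [/eqP-> /eqP->] : (l - p == 0 /\ l.+1 - p == 0)%N.
    by rewrite !subn_eq0 ltlp ltnW.
  by rewrite (minn_idPl ltlp) !mulr1 exprSr.
by rewrite (minn_idPr (leqW lepl)) subSn // exprSr mulrA.
Qed.

(** With the points x (p times), then y, the l-th Newton polynomial is divisible
    by enough powers of X - x and X - y to be killed by all the functionals that
    precede the l-th one. *)
Lemma confluentE m p x y e :
  confluent m p x y e = confluent_vandermonde m p x y *
    \det (\matrix_(i < m, j < m) newton_coef (node p x y) (e j) i).
Proof.
pose phi i : {scalar {poly A}} := euler_at (local_index p i) (node p x y i).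
transitivity (\det (\matrix_(i < m, j < m) phi i 'X^(e j))).
  by congr (\det _); apply/matrixP => i j; rewrite !mxE /= euler_atXn.
rewrite (@det_functionals _ m phi (node p x y)) /=; last first.
  move=> i l _ ltil; rewrite newton_poly_node /local_index /node.
  case: ltnP => [ltip|lepi]; first by rewrite euler_at_lt // leq_min ltil.
  by rewrite mulrC euler_at_lt // ltn_sub2r // (leq_ltn_trans lepi).
congr (_ * _); apply: eq_bigr => i _ /=; rewrite newton_poly_node.
rewrite /local_index /node; case: ltnP => [ltip|lepi].
  have /eqP -> : (i - p == 0)%N by rewrite subn_eq0 ltnW.
  by rewrite euler_at_eq hornerE.
by rewrite mulrC euler_at_eq !hornerE.
Qed.

Lemma confluent_incr m p x y : confluent m p x y id = confluent_vandermonde m p x y.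
Proof. by rewrite confluentE det_newton_coef_incr mulr1. Qed.

Lemma det_scale_rows m (c : 'I_m -> A) (M : 'I_m -> 'I_m -> A) :
  \det (\matrix_(i, j) (c i * M i j)) = \prod_i c i * \det (\matrix_(i, j) M i j).
Proof.
rewrite -[\prod_i c i](_ : \det (diag_mx (\row_i c i)) = _); last first.
  by rewrite det_diag; apply: eq_bigr => i _; rewrite mxE.
rewrite -det_mulmx mul_diag_mx; congr (\det _).
by apply/matrixP => i j; rewrite !mxE.
Qed.

Lemma det_scale_cols m (c : 'I_m -> A) (M : 'I_m -> 'I_m -> A) :
  \det (\matrix_(i, j) (c j * M i j)) = \prod_i c i * \det (\matrix_(i, j) M i j).
Proof.
rewrite -[\prod_i c i](_ : \det (diag_mx (\row_i c i)) = _); last first.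
  by rewrite det_diag; apply: eq_bigr => i _; rewrite mxE.
rewrite mulrC -det_mulmx mul_mx_diag; congr (\det _).
by apply/matrixP => i j; rewrite !mxE mulrC.
Qed.

(** Replacing the powers of z in the two blocks of rows by polynomials of the
    same degrees amounts to a lower triangular change of rows. *)
Lemma det_poly_rows m p (P : nat -> {poly A}) (z : nat -> A) (w : bool -> nat -> A) :
  (p <= m)%N -> (forall k, (size (P k) <= k.+1)%N) ->
  \det (\matrix_(i < m, j < m) ((P (local_index p i)).[z j] * w (i < p)%N j)) =
  \prod_(i < m) (P (local_index p i))`_(local_index p i) *
  \det (\matrix_(i < m, j < m) (z j ^+ local_index p i * w (i < p)%N j)).
Proof.
move=> lepm sizeP.
pose L := \matrix_(i < m, l < m)
  (if (i < p)%N == (l < p)%N then (P (local_index p i))`_(local_index p l) else 0).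
have -> : \prod_(i < m) (P (local_index p i))`_(local_index p i) = \det L.
  rewrite det_trig; first by apply: eq_bigr => i _; rewrite mxE eqxx.
  apply/is_trig_mxP => i l ltil; rewrite mxE; case: eqP => // same.
  apply: nth_default; apply: leq_trans (sizeP _) _.
  move: same; rewrite /local_index; case: ltnP => [ltip <-//|lepi <-].
  by rewrite ltn_sub2r // (leq_ltn_trans lepi).
rewrite -det_mulmx; congr (\det _); apply/matrixP => i j; rewrite !mxE.
under eq_bigr do rewrite !mxE.
rewrite -(big_mkord xpredT (fun l : nat => (if (i < p)%N == (l < p)%N
   then (P (local_index p i))`_(local_index p l) else 0) *
   (z j ^+ local_index p l * w (l < p)%N j))) /=.
rewrite (big_cat_nat (leq0n p)) //=; case: ltnP => [ltip|lepi].
  rewrite [X in _ + X]big_nat_cond [X in _ + X]big1 ?addr0; last first.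
    by move=> l; rewrite andbT => /andP[lepl _]; rewrite ltnNge lepl mul0r.
  rewrite big_mkord (@horner_coef_wide _ p); last first.
    by apply: leq_trans (sizeP _) _; rewrite /local_index ltip.
  rewrite mulr_suml; apply: eq_bigr => l _.
  by rewrite ltn_ord /= /local_index ltn_ord mulrA.
rewrite big_nat_cond big1 ?add0r; last first.
  by move=> l; rewrite andbT => /andP[_ ltlp]; rewrite ltlp mul0r.
rewrite -[in index_iota p m](add0n p) big_addn big_mkord.
rewrite (@horner_coef_wide _ (m - p)); last first.
  apply: leq_trans (sizeP _) _; rewrite /local_index (ltnNge i) lepi /=.
  by rewrite ltn_sub2r // (leq_ltn_trans lepi).
rewrite mulr_suml; apply: eq_bigr => l _.
by rewrite ltnNge leq_addl /= /local_index (ltnNge (l + p)%N) leq_addl addnK mulrA.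
Qed.

(** The powers of e + g are combinations of the powers of e with leading
    coefficient 1; hence only the factors x^g and y^g come out. *)
Lemma confluent_shift m p x y e g : (p <= m)%N ->
  confluent m p x y (fun j => e j + g)%N =
  \prod_(i < m) node p x y i ^+ g * confluent m p x y e.
Proof.
move=> lepm; rewrite /confluent.
pose P k := ('X + g%:R%:P : {poly A}) ^+ k.
have sizeP k : size (P k) = k.+1.
  by rewrite /P -[g%:R%:P]opprK -polyCN size_exp_XsubC.
have leadP k : (P k)`_k = 1.
  have := monic_exp k (monicXsubC (- g%:R : A)).
  by rewrite polyCN opprK => /monicP <-; rewrite lead_coefE sizeP.
pose w (s : bool) j := (if s then x else y) ^+ e j.
have := @det_poly_rows m p P (fun j => (e j)%:R) w lepm (fun k => eq_leq (sizeP k)).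
under eq_bigr do rewrite leadP; rewrite big1 // mul1r => <-.
rewrite -det_scale_rows; congr (\det _); apply/matrixP => i j; rewrite !mxE.
rewrite /P horner_exp hornerD hornerX hornerC /w /node natrD exprD.
by case: ifP => _; rewrite [_ ^+ e j * _]mulrC mulrCA.
Qed.

(** x^e y^N = (x y)^e y^(N - e), and the powers of e are, up to sign, triangular
    combinations of those of N - e. *)
Lemma confluent_reverse m p x y e N : (p <= m)%N ->
  (forall j, (j < m)%N -> (e j <= N)%N) ->
  \prod_(i < m) node p y x i ^+ N * confluent m p x y e =
  \prod_(i < m) (-1) ^+ local_index p i * \prod_(j < m) (x * y) ^+ e j *
    confluent m p y x (fun j => N - e j)%N.
Proof.
move=> lepm eN; rewrite /confluent -det_scale_rows.
pose P k := (N%:R%:P - 'X : {poly A}) ^+ k.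
have PE k : P k = (-1) ^+ k *: ('X - N%:R%:P) ^+ k.
  rewrite /P -opprB [in LHS]exprNn -[in RHS]signr_odd scaler_sign.
  by rewrite -[in LHS]signr_odd mulr_sign.
have sizeP k : (size (P k) <= k.+1)%N.
  by rewrite PE (leq_trans (size_scale_leq _ _)) // size_exp_XsubC.
have leadP k : (P k)`_k = (-1) ^+ k.
  rewrite PE coefZ -[k in _`_k]/(k.+1.-1) -(size_exp_XsubC k (N%:R : A)).
  by rewrite -lead_coefE (monicP (monic_exp k (monicXsubC _))) mulr1.
pose w (s : bool) j := (if s then y else x) ^+ (N - e j).
have := @det_poly_rows m p P (fun j => (N - e j)%:R) w lepm sizeP.
under eq_bigr do rewrite leadP.
rewrite -mulrA mulrCA => <-; rewrite -det_scale_cols; congr (\det _).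
apply/matrixP => i j; rewrite !mxE /P /w.
rewrite horner_exp hornerD hornerN hornerX hornerC.
rewrite natrB ?eN // opprB addrC subrK exprMn.
rewrite -{1}(subnKC (eN j (ltn_ord j))) /node exprD.
by case: ifP => _; ring.
Qed.

(** Exchanging the two blocks of rows costs a sign which is the same for all
    exponents, and thus cancels against the case of the empty partition. *)
Lemma confluent_swap p q : exists s : bool, forall x y e,
  confluent (p + q) p x y e = (-1) ^+ s * confluent (p + q) q y x e.
Proof.
pose swap (i : 'I_(p + q)) := (if i < p then i + q else i - p)%N.
have swap_lt i : (swap i < p + q)%N.
  rewrite /swap; case: (ltnP i p) => [ltip|lepi]; first by rewrite ltn_add2r.
  by rewrite (leq_ltn_trans (leq_subr _ _)).
pose f i := Ordinal (swap_lt i).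
have f_inj : injective f.
  move=> i j /(congr1 val) /=; rewrite /swap => fij; apply: val_inj => /=.
  have := ltn_ord i; have := ltn_ord j; move: fij.
  case: (ltnP i p) => ip; case: (ltnP j p) => jp.
  - by move/addIn.
  - move=> eq_ij ltj _; move: ltj; rewrite -(subnK jp) -eq_ij addnC ltn_add2l.
    by rewrite ltnNge leq_addl.
  - move=> eq_ij _; rewrite -(subnK ip) eq_ij addnC ltn_add2l.
    by rewrite ltnNge leq_addl.
  - by move=> eq_ij _ _; rewrite -(subnK ip) eq_ij subnK.
exists (odd_perm (perm f_inj)) => x y e; rewrite /confluent -det_perm.
rewrite -det_mulmx -row_permE; congr (\det _); apply/matrixP => i j.
rewrite !mxE permE /= /local_index /node /swap.
case: (ltnP i p) => [ltip|lepi]; first by rewrite ltnNge leq_addl addnK.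
by rewrite ltn_subLR // ltn_ord.
Qed.

(** The exponent 0 contributes the column (1, 0, ..., 0), since every positive
    power of t d/dt kills constants; the other rows are those of a confluent
    alternant with one factor e_j taken out of each column. *)
Lemma det_first_column n k x y e : (k <= n)%N -> e 0%N = 0%N ->
  \det (\matrix_(i < n.+1, j < n.+1)
    ((e j)%:R ^+ (if (i <= k)%N then i : nat else i - k)%N *
     node k.+1 x y i ^+ e j)) =
  \prod_(j < n) (e j.+1)%:R * confluent n k x y (fun j => e j.+1).
Proof.
move=> lekn e0; rewrite (expand_det_col _ ord0) big_ord_recl big1 => [|i _].
  rewrite mxE e0 /= !expr0 !mul1r addr0 /cofactor expr0 mul1r.
  rewrite /confluent -det_scale_cols; congr (\det _); apply/matrixP => i j.
  rewrite !mxE /= /bump /= !add1n /local_index /node !ltnS.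
  case: ltnP => [ltik|leki]; first by rewrite exprS mulrA.
  by rewrite subSn // exprS mulrA.
rewrite mxE e0 /= /bump /= add1n; case: ltnP => [ltik|leki]; last rewrite subSn //.
  by rewrite exprS !mul0r.
by rewrite exprS !mul0r.
Qed.

Lemma eq_confluent m p x y (e e' : nat -> nat) :
  (forall j, (j < m)%N -> e j = e' j) -> confluent m p x y e = confluent m p x y e'.
Proof.
move=> ee; congr (\det _); apply/matrixP => i j.
by rewrite !mxE ee.
Qed.

End Confluent.

Lemma prod_node (R : comNzRingType) p q (x y : R) g :
  \prod_(i < p + q) node p x y i ^+ g = x ^+ (p * g) * y ^+ (q * g).
Proof.
rewrite big_split_ord /=; congr (_ * _).
  under eq_bigr => i _ do rewrite /node ltn_ord.
  by rewrite prodr_const card_ord mulnC exprM.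
under eq_bigr => i _ do rewrite /node ltnNge leq_addr.
by rewrite prodr_const card_ord mulnC exprM.
Qed.

Lemma confluent_vandermondeE (R : comNzRingType) p q (x y : R) :
  confluent_vandermonde (p + q) p x y =
  \prod_(i < p) (i`!%:R * x ^+ i) * \prod_(i < q) (i`!%:R * y ^+ i) *
  (y - x) ^+ (p * q).
Proof.
rewrite /confluent_vandermonde big_split_ord /= -mulrA; congr (_ * _).
  by apply: eq_bigr => i _; rewrite /local_index /node ltn_ord mulr1.
have -> : (y - x) ^+ (p * q) = \prod_(i < q) (y - x) ^+ p.
  by rewrite prodr_const card_ord exprM.
rewrite -big_split /=.
apply: eq_bigr => i _.
by rewrite /local_index /node ltnNge leq_addr /= addKn.
Qed.

(** Factorials and powers match on both sides, and the exponents of y - x differ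
    by (r + 1)(s + 1) + r s - (r + 1) s - r (s + 1) = 1. *)
Lemma confluent_vandermonde_rec (R : comNzRingType) r s (x y : R) :
  confluent_vandermonde (r + s).+1 r.+1 x y *
    confluent_vandermonde (r + s).+1 r x y * (y - x) =
  confluent_vandermonde (r + s).+2 r.+1 x y * confluent_vandermonde (r + s) r x y.
Proof.
have -> : confluent_vandermonde (r + s).+2 r.+1 x y =
  confluent_vandermonde (r.+1 + s.+1) r.+1 x y by rewrite addSn addnS.
have -> : confluent_vandermonde (r + s).+1 r x y =
  confluent_vandermonde (r + s.+1) r x y by rewrite addnS.
rewrite -[(r + s).+1]addSn !confluent_vandermondeE.
rewrite (_ : r.+1 * s.+1 = r.+1 * s + r + 1)%N; last by lia.
rewrite (_ : r * s.+1 = r * s + r)%N; last by lia.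
by rewrite !exprD expr1; ring.
Qed.

(** The form of Cramer's rule needed here: the cofactors along row r do not see
    the entries of that row, so that M and M' have the same column of cofactors,
    of which both determinants are read off by comparison with c != 0. *)
Lemma det_replace_row (R : fieldType) m (M M' : 'M[R]_m) (c : 'cV[R]_m)
    (r : 'I_m) (t : R) :
  (forall i, i != r -> row i M = row i M') ->
  M *m c = delta_mx r 0 -> M' *m c = t *: delta_mx r 0 ->
  \det M' = t * \det M.
Proof.
move=> eqM Mc M'c.
have adj_eq : \adj M' *m delta_mx r (0 : 'I_1) = \adj M *m delta_mx r 0.
  apply/matrixP => i j; rewrite -!colE !mxE.
  rewrite /cofactor; congr (_ * \det _); apply/matrixP => k l; rewrite !mxE.
  have /eqM/rowP/(_ (lift i l)) : lift r k != r by rewrite eq_sym neq_lift.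
  by rewrite !mxE.
have detM : \det M *: c = \adj M *m delta_mx r 0.
  by rewrite -Mc mulmxA mul_adj_mx mul_scalar_mx.
have detM' : \det M' *: c = t *: (\det M *: c).
  by rewrite detM -adj_eq scalemxAr -M'c mulmxA mul_adj_mx mul_scalar_mx.
have /eqP : (\det M' - t * \det M) *: c = 0.
  by rewrite scalerBl detM' scalerA subrr.
rewrite scaler_eq0 subr_eq0 => /orP[/eqP //|/eqP c0].
move/matrixP/(_ r 0): Mc; rewrite c0 mulmx0 !mxE !eqxx => /esym/eqP.
by rewrite oner_eq0.
Qed.

(** The coefficients of F solve the system whose rows are the functionals of the
    confluent alternant with k points a and n + 1 - k points b, the right-hand
    side being the unit vector of the first condition at b, F(b) = 1.
    Trading that condition for the value of theta^k F at a only multiplies the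
    right-hand side by that value, and produces the matrix of
    [det_first_column]. *)
Lemma euler_at_confluent (R : fieldType) n k (e : nat -> nat) (c : 'I_n.+1 -> R)
    (a b : R) :
  (k <= n)%N -> e 0%N = 0%N ->
  let F := \sum_(j < n.+1) c j *: 'X^(e j) in
  (forall i, (i < k)%N -> euler_at i a F = 0) ->
  (forall i, (i <= n - k)%N -> euler_at i b F = (i == 0%N)%:R) ->
  euler_at k a F * confluent n.+1 k a b e =
  \prod_(j < n) (e j.+1)%:R * confluent n k a b (fun j => e j.+1).
Proof.
move=> lekn e0 F Fa Fb; rewrite -det_first_column //.
have FE i x : euler_at i x F = \sum_j (e (nat_of_ord j))%:R ^+ i * x ^+ e j * c j.
  rewrite linear_sum /=; apply: eq_bigr => j _.
  by rewrite linearZ /= euler_atXn mulrC.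
have ltkn : (k < n.+1)%N by [].
symmetry; apply: (@det_replace_row _ _ _ _ (\col_j c j) (Ordinal ltkn)).
- move=> i; rewrite -val_eqE /= => neq_ik; apply/rowP => j; rewrite !mxE.
  rewrite /local_index /node ltnS.
  by rewrite (leq_eqVlt i k) (negPf neq_ik).
- apply/colP => i; rewrite !mxE -val_eqE /= andbT.
  under eq_bigr do rewrite !mxE.
  rewrite -(FE (local_index k i) (node k a b i)) /local_index /node.
  case: ltnP => [ltik|leki]; first by rewrite Fa // ltn_eqF.
  rewrite Fb; last by have := ltn_ord i; lia.
  by congr (nat_of_bool _)%:R; lia.
- apply/colP => i; rewrite !mxE -val_eqE /= andbT.
  under eq_bigr do rewrite !mxE.
  rewrite -(FE (if (i <= k)%N then i : nat else (i - k)%N) (node k.+1 a b i)).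
  rewrite /node ltnS.
  case: ltngtP => [ltik|ltki|->]; rewrite ?mulr0 ?mulr1 //.
    by rewrite Fa.
  rewrite Fb; last by have := ltn_ord i; lia.
  by have -> : (i - k == 0)%N = false by lia.
Qed.

(** * Muntz exponents *)

Lemma nth_partition n la i j : is_partition n la -> (i <= j)%N ->
  (nth 0 la j <= nth 0 la i)%N.
Proof.
move=> [_ sorted_la] leij; case: (ltnP j (size la)) => [ltj|gej].
  have geq_trans : transitive geq by move=> x y z /= yx zy; exact: leq_trans zy yx.
  have := @sorted_leq_nth _ geq geq_trans leqnn 0%N la sorted_la.
  by apply=> //; rewrite inE (leq_ltn_trans leij).
by rewrite nth_default.
Qed.

Lemma behead_partition n la : is_partition n.+1 la -> is_partition n (behead la).
Proof.
move=> [size_la sorted_la]; split; first by rewrite size_behead; lia.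
by case: la sorted_la {size_la} => //= x s /path_sorted.
Qed.

Lemma partitionW n m la : (n <= m)%N -> is_partition n la -> is_partition m la.
Proof. by move=> lenm [size_la ?]; split=> //; exact: leq_trans lenm. Qed.

Lemma muntz_exp0 la : muntz_exp la 0 = 0%N.
Proof. by rewrite /muntz_exp subnn. Qed.

(** Dropping the first part of the partition removes the exponent 0 and lowers
    all others by the same amount, which is 1 when the first two parts agree. *)
Lemma muntz_expS n la j : is_partition n la ->
  muntz_exp la j.+1 = (muntz_exp (behead la) j + (nth 0 la 0 - nth 0 la 1).+1)%N.
Proof.
move=> part; rewrite /muntz_exp !nth_behead.
have := nth_partition part (leq0n 1); have := nth_partition part (ltn0Sn j).
lia.
Qed.

(** * Confluent alternants as Schur values *)

Section ConfluentSchur.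
Variable R : realType.
Implicit Types (a b x y : R) (la : seq nat).

(** Both alternants have the same Vandermonde factor, and their determinants of
    divided differences are those of [schurE], up to a sign which occurs twice. *)
Lemma schur2_confluent la x p y q :
  schur2 la x p y q * confluent (p + q) p x y (schur_exp (p + q) [::]) =
  confluent (p + q) p x y (schur_exp (p + q) la).
Proof.
have -> : schur2 la x p y q = schur la (fun i : 'I_(p + q) => node p x y i) by [].
rewrite schurE !confluentE.
have -> : \det (\matrix_(i < p + q, j < p + q)
    newton_coef (node p x y) (schur_exp (p + q) [::] j) i) = rev_sign R (p + q).
  rewrite -(det_newton_coef_decr (node p x y)); congr (\det _).
  by apply/matrixP => i j; rewrite !mxE /schur_exp nth_nil.
by rewrite mulrACA mulrAC [_ * rev_sign _ _]mulrC !mulrA rev_sign_sqr mul1r mulrC.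
Qed.

Lemma node_prod_neq0 m p x y N : x != 0 -> y != 0 ->
  \prod_(i < m) node p x y i ^+ N != 0.
Proof.
move=> x0 y0; apply/prodf_neq0 => i _; rewrite expf_neq0 // /node.
by case: ifP.
Qed.

(** Reversing the Muntz exponents with respect to lambda_1 + m - 1, where
    m = q + p, gives the exponents of the Schur alternant of lambda.  The same
    reversal for the empty partition has the same sign, so the quotient of the
    two identities is sign free. *)
Lemma confluent_muntz n la p q a b : is_partition n la -> (0 < q + p)%N ->
  a != 0 -> b != 0 ->
  \prod_(i < q + p) node p b a i ^+ nth 0%N la 0 *
    confluent (q + p) p a b (muntz_exp la) =
  (a * b) ^+ (\sum_(j < q + p) (nth 0 la 0 - nth 0 la j))%N *
    schur2 la a q b p * confluent_vandermonde (q + p) p a b.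
Proof.
move=> part m_gt0 a0 b0; set m := (q + p)%N in m_gt0 *; set l1 := nth 0%N la 0.
have lela j := nth_partition part (leq0n j).
have W0 := @node_prod_neq0 m p b a m.-1 b0 a0.
have lepm : (p <= m)%N := leq_addl _ _.
have [s swap] := confluent_swap R q p.
have rev_la := @confluent_reverse R m p a b (muntz_exp la) (l1 + m.-1) lepm.
have rev_0 := @confluent_reverse R m p a b id m.-1 lepm.
rewrite (@eq_confluent _ m p b a _ (schur_exp m la)) in rev_la; last first.
  by move=> j ltjm; rewrite /muntz_exp /schur_exp; have := lela j; lia.
rewrite (@eq_confluent _ m p b a _ (schur_exp m [::])) in rev_0; last first.
  by move=> j ltjm; rewrite /schur_exp nth_nil; lia.
have {}rev_la := rev_la
  ltac:(by move=> j ltjm; rewrite /muntz_exp; have := lela j; lia).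
have {}rev_0 := rev_0 ltac:(by move=> j ltjm; lia).
have swap' e : confluent m p b a e = (-1) ^+ s * confluent m q a b e.
  by rewrite swap mulrA -expr2 sqrr_sign mul1r.
rewrite swap' -schur2_confluent -/m in rev_la.
rewrite swap' confluent_incr in rev_0.
apply: (mulfI W0); rewrite mulrA.
have -> : \prod_(i < m) node p b a i ^+ m.-1 * \prod_(i < m) node p b a i ^+ l1 =
    \prod_(i < m) node p b a i ^+ (l1 + m.-1).
  by rewrite -big_split /=; apply: eq_bigr => i _; rewrite -exprD addnC.
rewrite rev_la [RHS]mulrCA rev_0.
have -> : \prod_(j < m) (a * b) ^+ muntz_exp la j =
    (a * b) ^+ (\sum_(j < m) (l1 - nth 0%N la j))%N * \prod_(j < m) (a * b) ^+ id j.
  by rewrite expr_sum -big_split /=; apply: eq_bigr => j _; rewrite -exprD.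
by rewrite !mulrA; ring.
Qed.

Lemma fSchur_confluent n la m : is_partition n la ->
  fSchur R la m * confluent_vandermonde m m 1 1 = confluent m m 1 1 (muntz_exp la).
Proof.
move=> part; case: m => [|m].
  rewrite /fSchur (@schurE R 0 la (fun _ => 1)) /confluent /rev_sign !det_mx00.
  by rewrite /confluent_vandermonde big_ord0 -det_perm det_mx00 !mulr1.
have := @confluent_muntz n la m.+1 0 1 1 part isT (oner_neq0 _) (oner_neq0 _).
rewrite mul1r expr1n mul1r add0n => <-; rewrite big1 ?mul1r // => i _.
by rewrite /node if_same expr1n.
Qed.

Lemma confluent_muntzS n la m k a b : is_partition n la -> (k <= m)%N ->
  confluent m k a b (fun j => muntz_exp la j.+1) =
  \prod_(i < m) node k a b i ^+ (nth 0%N la 0 - nth 0%N la 1).+1 *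
  confluent m k a b (muntz_exp (behead la)).
Proof.
move=> part lekm; rewrite -confluent_shift //; apply: eq_confluent => j _.
exact: muntz_expS part.
Qed.

Lemma confluent_one_point m n la a :
  is_partition n la ->
  confluent m.+1 m.+1 a a (muntz_exp la) =
  \prod_(j < m) (muntz_exp la j.+1)%:R *
    (\prod_(i < m) node m a a i ^+ (nth 0%N la 0 - nth 0%N la 1).+1 *
     confluent m m a a (muntz_exp (behead la))).
Proof.
move=> part.
rewrite -(confluent_muntzS _ _ part) // -det_first_column ?muntz_exp0 //.
congr (\det _); apply/matrixP => i j; rewrite !mxE /local_index ltn_ord.
by rewrite -ltnS ltn_ord.
Qed.

Lemma muntz_expS_neq0 n la j : is_partition n la -> (muntz_exp la j.+1)%:R != 0 :> R.
Proof. by move=> part; rewrite pnatr_eq0 (muntz_expS _ part) addnS. Qed.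

(** With a single point, the column expansion relates the alternant to that of
    the bottom partition with one exponent fewer, by nonzero factors. *)
Lemma confluent_one_point_neq0 m n la a : is_partition n la -> a != 0 ->
  confluent m m a a (muntz_exp la) != 0.
Proof.
move=> part a0; elim: m n la part => [|m IH] n la part.
  by rewrite /confluent det_mx00 oner_eq0.
rewrite (confluent_one_point _ _ part) mulf_neq0 //.
  by apply/prodf_neq0 => j _; exact: muntz_expS_neq0 part.
rewrite mulf_neq0 ?node_prod_neq0 //; apply: (IH n).
by apply: behead_partition; exact: partitionW part.
Qed.

(** Both sides come from the column expansion at the single point 1, where the
    alternants are numbers of tableaux times the superfactorials of
    [confluent_vandermonde]; two consecutive superfactorials have ratio m!. *)
Lemma fSchur_behead n la m : is_partition n la ->
  fSchur R la m.+1 * m`!%:R =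
  \prod_(j < m) (muntz_exp la j.+1)%:R * fSchur R (behead la) m.
Proof.
move=> part.
have part' : is_partition n (behead la).
  by apply: behead_partition; exact: partitionW part.
have V0 : confluent_vandermonde m m (1 : R) 1 != 0.
  apply/prodf_neq0 => i _; rewrite ltn_ord mulr1 /node if_same expr1n mulr1.
  by rewrite pnatr_eq0 -lt0n fact_gt0.
apply: (mulIf V0).
rewrite -[RHS]mulrA (fSchur_confluent m part').
have := confluent_one_point m 1 part.
rewrite -(fSchur_confluent _ part).
rewrite [X in _ * (X * _)]big1 => [|i _]; last by rewrite /node if_same expr1n.
rewrite [X in _ * X = _ -> _](_ : _ = m`!%:R * confluent_vandermonde m m 1 1).
  by rewrite !mul1r mulrA.
rewrite /confluent_vandermonde big_ord_recr /= mulrC /local_index /node ltnS leqnn.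
rewrite expr1n !mulr1; congr (_ * _); apply: eq_bigr => i _ /=.
by rewrite ltn_ord ltnS ltnW.
Qed.

Lemma fSchur_neq0 n la m : is_partition n la -> fSchur R la m != 0.
Proof.
move=> part; apply/negP => /eqP f0.
have := confluent_one_point_neq0 m part (oner_neq0 R).
by rewrite -(fSchur_confluent _ part) f0 mul0r eqxx.
Qed.

(** The numbers of tableaux enter through two consecutive quotients, whose
    factorials combine to the factor n. *)
Lemma gbinomE n la : is_partition n.+1 la ->
  n.+1%:R / gbinom R la n.+1 =
  \prod_(j < n.+1) (muntz_exp la j.+1)%:R /
  \prod_(j < n) (muntz_exp (behead la) j.+1)%:R.
Proof.
move=> part; have part0 := behead_partition part.
have := fSchur_behead n.+1 part; have := fSchur_behead n part0.
rewrite /gbinom /bottom_partition /=.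
set f := fSchur R la _; set f0 := fSchur R (behead la) _; set f1 := fSchur R _ n.
set p0 := \prod_(j < n) _; set p := \prod_(j < n.+1) _.
have f_0 : f != 0 := fSchur_neq0 _ part.
have f0_0 : f0 != 0 := fSchur_neq0 _ part0.
have f1_0 : f1 != 0.
  apply: (@fSchur_neq0 n); apply: behead_partition.
  by apply: partitionW part0; lia.
have p0_0 : p0 != 0 by apply/prodf_neq0 => j _; exact: muntz_expS_neq0 part0.
have fact0 : n`!%:R != 0 :> R by rewrite pnatr_eq0 -lt0n fact_gt0.
move=> e0 e; rewrite factS natrM mulrA in e.
have -> : p = f * n.+1%:R * n`!%:R / f0 by rewrite e mulfK.
have -> : p0 = f0 * n`!%:R / f1 by rewrite e0 mulfK.
by field; rewrite ?f_0 ?f0_0 ?f1_0 ?fact0.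
Qed.

End ConfluentSchur.

(** * Chebyshev-Bernstein bases of polynomials *)

Section PolynomialBasis.
Variable R : fieldType.
Implicit Types (a b : R) (P : nat -> {poly R}) (e : nat -> nat).

(** Chebyshev-Bernstein bases among polynomials, with respect to the exponents
    e_0, ..., e_n; vanishing is expressed by iterates of t d/dt, which agrees
    with the usual notion at nonzero points. *)
Definition CB_poly n e a b P : Prop :=
  [/\ exists2 C : 'M[R]_n.+1, C \in unitmx &
        forall k : 'I_n.+1, P k = \sum_(j < n.+1) C k j *: 'X^(e j),
      \sum_(k < n.+1) P k = 1 &
      forall k, (k <= n)%N ->
        (forall i, (i < k)%N -> euler_at i a (P k) = 0) /\
        (forall i, (i < n - k)%N -> euler_at i b (P k) = 0)].

(** Exchanging the end points reverses the order of the basis; facts about the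
    zeros at b follow from those at a. *)
Lemma CB_poly_rev n e a b P :
  CB_poly n e a b P -> CB_poly n e b a (fun k => P (n - k)%N).
Proof.
move=> [[C Cu PE] P1 Pab]; split.
- exists (row_perm (perm (@rev_ord_inj n.+1)) C).
    by rewrite row_permE unitmx_mul unitmx_perm.
  move=> k; rewrite -[(n - k)%N]/(val (rev_ord k)) PE.
  by apply: eq_bigr => j _; rewrite mxE permE.
- rewrite -P1 (reindex_inj rev_ord_inj) /=; apply: eq_bigr => k _.
  by congr P; have := ltn_ord k; lia.
- move=> k lekn; have [Pa Pb] := Pab _ (leq_subr k n); split=> i lti.
    by apply: Pb; lia.
  by apply: Pa.
Qed.

Lemma CB_poly_span n e a b P (v : nat -> R) : CB_poly n e a b P ->
  exists2 y : 'rV[R]_n.+1,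
    \sum_(j < n.+1) v j *: 'X^(e j) = \sum_(k < n.+1) y 0 k *: P k &
    y = 0 -> forall j : 'I_n.+1, v j = 0.
Proof.
move=> [[C Cu PE] _ _]; pose w := \row_(j < n.+1) v j.
exists (w *m invmx C) => [|y0 j]; last first.
  by have := mulmxKV Cu w; rewrite y0 mul0mx => /rowP/(_ j); rewrite !mxE.
under [RHS]eq_bigr do rewrite PE scaler_sumr.
rewrite exchange_big /=; apply: eq_bigr => j _.
under eq_bigr do rewrite scalerA.
rewrite -scaler_suml; congr (_ *: _).
by have /rowP/(_ j) := mulmxKV Cu w; rewrite !mxE.
Qed.

(** The matrix (theta^i P_k (a)) is lower triangular, and it is the product of
    the matrix of the one-point alternant with an invertible matrix of
    coefficients. *)
Lemma CB_poly_diag_neq0 n e a b P k : CB_poly n e a b P ->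
  confluent n.+1 n.+1 a a e != 0 -> (k <= n)%N -> euler_at k a (P k) != 0.
Proof.
move=> [[C Cu PE] _ Pab] det0 lekn.
have : \det (\matrix_(i < n.+1, k < n.+1) euler_at i a (P k)) != 0.
  have -> : \matrix_(i < n.+1, k < n.+1) euler_at i a (P k) =
      (\matrix_(i < n.+1, j < n.+1) ((e j)%:R ^+ local_index n.+1 i *
         node n.+1 a a i ^+ e j)) *m C^T.
    apply/matrixP => i l; rewrite !mxE PE linear_sum /=.
    apply: eq_bigr => j _; rewrite linearZ /= euler_atXn !mxE mulrC.
    by rewrite /local_index /node ltn_ord.
  by rewrite det_mulmx mulf_neq0 // det_tr -unitfE -unitmxE.
rewrite det_trig; last first.
  by apply/is_trig_mxP => i l ltil; rewrite mxE (Pab l _).1 // -ltnS.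
have ltk : (k < n.+1)%N by [].
by move/prodf_neq0/(_ (Ordinal ltk) isT); rewrite mxE.
Qed.

(** Triangularity at a: the coordinates are killed one after the other, by
    increasing order of vanishing. *)
Lemma CB_poly_coord_eq0 n e a b P (y : 'rV[R]_n.+1) r : CB_poly n e a b P ->
  confluent n.+1 n.+1 a a e != 0 ->
  (forall i, (i < r)%N -> euler_at i a (\sum_(k < n.+1) y 0 k *: P k) = 0) ->
  forall k : 'I_n.+1, (k < r)%N -> y 0 k = 0.
Proof.
move=> PB det0 F0; have [_ _ Pab] := PB.
suff H l (k : 'I_n.+1) : val k = l -> (l < r)%N -> y 0 k = 0 by move=> k; exact: H.
elim/ltn_ind: l k => l IH k kl ltkr; rewrite -kl /= in IH ltkr.
have /eqP := F0 k ltkr; rewrite linear_sum (bigD1 k) //= big1 => [|j neq_jk].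
  rewrite addr0 linearZ /= mulf_eq0 => /orP[/eqP //|].
  by rewrite (negPf (CB_poly_diag_neq0 PB det0 _)) // -ltnS.
rewrite linearZ /=; move: neq_jk; rewrite neq_ltn => /orP[ltjk|ltkj].
  by rewrite (IH j ltjk j erefl) ?mul0r // (ltn_trans ltjk).
by rewrite (Pab j _).1 ?mulr0 // -ltnS.
Qed.

Lemma CB_poly_coord_eq0_rev n e a b P (y : 'rV[R]_n.+1) r : CB_poly n e a b P ->
  confluent n.+1 n.+1 b b e != 0 ->
  (forall i, (i < r)%N -> euler_at i b (\sum_(k < n.+1) y 0 k *: P k) = 0) ->
  forall k : 'I_n.+1, (n < k + r)%N -> y 0 k = 0.
Proof.
move=> PB det0 F0 k ltk.
have := @CB_poly_coord_eq0 _ _ _ _ _ (\row_k y 0 (rev_ord k)) r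
  (CB_poly_rev PB) det0.
move=> /(_ _ (rev_ord k)); rewrite mxE rev_ordK; apply; last first.
  by rewrite /=; have := ltn_ord k; lia.
move=> i ltir; rewrite -(F0 i ltir) (reindex_inj rev_ord_inj) /=.
congr (euler_at i b _); apply: eq_bigr => j _; rewrite mxE rev_ordK.
by congr (_ *: P _); have := ltn_ord j; lia.
Qed.

(** A vector in the kernel is an element of the space with k zeros at a and
    n + 1 - k zeros at b.  The former kill its coordinates of index less than k,
    the latter all the others. *)
Lemma CB_poly_confluent_neq0 n e a b P k : CB_poly n e a b P ->
  confluent n.+1 n.+1 a a e != 0 -> confluent n.+1 n.+1 b b e != 0 ->
  (k <= n.+1)%N -> confluent n.+1 k a b e != 0.
Proof.
move=> PB deta detb lekn; rewrite /confluent -det_tr.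
apply/det0P => -[v v0 vM]; case/negP: v0; apply/eqP/rowP => j0.
pose c j := if insub j is Some i then v 0 i else 0.
have cE (j : 'I_n.+1) : c j = v 0 j by rewrite /c valK.
have [y Fy y0] := CB_poly_span c PB.
rewrite !mxE -cE; apply: (y0 _ j0); apply/rowP => l; rewrite mxE.
have F0 (i : 'I_n.+1) :
    euler_at (local_index k i) (node k a b i) (\sum_(l < n.+1) y 0 l *: P l) = 0.
  rewrite -Fy linear_sum /=; have /rowP/(_ i) := vM; rewrite !mxE => vMi.
  rewrite -[RHS]vMi; apply: eq_bigr => j _.
  by rewrite linearZ /= euler_atXn cE !mxE.
case: (ltnP l k) => [ltlk|lekl].
  apply: (CB_poly_coord_eq0 PB deta (r := k)) => // i ltik.
  have := F0 (Ordinal (leq_trans ltik lekn)).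
  by rewrite /local_index /node ltik.
apply: (CB_poly_coord_eq0_rev PB detb (r := n.+1 - k)); last first.
  by have := ltn_ord l; lia.
move=> i lti; have ltik : (i + k < n.+1)%N by lia.
have := F0 (Ordinal ltik).
by rewrite /local_index /node ltnNge leq_addl /= addnK.
Qed.

Definition tail n P k : {poly R} := \sum_(k <= j < n.+1) P j.

Lemma tailS n P k : (k <= n)%N -> P k = tail n P k - tail n P k.+1.
Proof. by move=> lekn; rewrite /tail big_ltn // addrK. Qed.

Lemma euler_at_tail_left n e a b P k : CB_poly n e a b P -> (k <= n)%N ->
  (forall i, (i < k)%N -> euler_at i a (tail n P k) = 0) /\
  euler_at k a (tail n P k) = euler_at k a (P k).
Proof.
move=> [_ _ Pab] lekn; split=> [i ltik|].
  rewrite linear_sum big_nat_cond big1 //= => j; rewrite andbT => /andP[lekj ltjn].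
  by rewrite (Pab j _).1 // (leq_trans ltik).
rewrite /tail big_ltn // linearD linear_sum /= big_nat_cond big1 ?addr0 //= => j.
by rewrite andbT => /andP[ltkj ltjn]; rewrite (Pab j _).1.
Qed.

(** As the basis sums to 1, a tail is 1 minus a head, and the heads vanish
    at b. *)
Lemma euler_at_tail_right n e a b P k i : CB_poly n e a b P -> (k <= n)%N ->
  (i <= n - k)%N -> euler_at i b (tail n P k) = (i == 0%N)%:R.
Proof.
move=> [_ P1 Pab] lekn leik.
have -> : tail n P k = 1 - \sum_(0 <= j < k) P j.
  rewrite -P1 -(big_mkord xpredT P) (big_cat_nat (leq0n k)) /=; last exact: leqW.
  by rewrite addrC addrK.
rewrite linearB linear_sum /= big_nat_cond big1 => [|j]; last first.
  by rewrite andbT => /andP[_ ltjk]; rewrite (Pab j _).2 //; lia.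
rewrite subr0 -(expr0 'X) euler_atXn mulr1.
by case: i {leik} => [|i]; rewrite ?expr0 // exprS mul0r.
Qed.

Lemma tail_span n e a b P k : CB_poly n e a b P ->
  exists c : 'I_n.+1 -> R, tail n P k = \sum_(j < n.+1) c j *: 'X^(e j).
Proof.
move=> [[C _ PE] _ _]; exists (fun j => \sum_(i < n.+1 | (k <= i)%N) C i j).
rewrite /tail; transitivity (\sum_(i < n.+1 | (k <= i)%N) P i).
  rewrite -(big_mkord (fun i => k <= i)%N P) [RHS]big_mkcond /=.
  case: (leqP k n.+1) => [lek|gtk].
    rewrite (big_cat_nat (leq0n k)) //=.
    have -> : \sum_(0 <= i < k) (if (k <= i)%N then P i else 0) = 0.
      rewrite big_nat_cond big1 // => i; rewrite andbT => /andP[_ ltik].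
      by rewrite leqNgt ltik.
    by rewrite add0r; apply: eq_big_nat => i /andP[-> _].
  rewrite big_geq ?(ltnW gtk) // big_nat_cond big1 // => i.
  by rewrite andbT => /andP[_ lti]; rewrite leqNgt (ltn_trans lti gtk).
under eq_bigr do rewrite PE.
by rewrite exchange_big /=; apply: eq_bigr => j _; rewrite scaler_suml.
Qed.

Lemma euler_at_CB_poly n e a b P k :
  CB_poly n e a b P -> e 0%N = 0%N -> (k <= n)%N ->
  euler_at k a (P k) * confluent n.+1 k a b e =
  \prod_(j < n) (e j.+1)%:R * confluent n k a b (fun j => e j.+1).
Proof.
move=> PB e0 lekn; have [Ta Tk] := euler_at_tail_left PB lekn.
have Tb i := @euler_at_tail_right _ _ _ _ _ k i PB lekn.
have [c Tc] := tail_span k PB.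
rewrite -Tk Tc; apply: euler_at_confluent => // i; rewrite -Tc; first exact: Ta.
exact: Tb.
Qed.

(** The derivative lies in the space of the second basis, where its zeros at a
    kill the coordinates before r and its zeros at b those after r.  The
    remaining coordinate is read off from the leading behaviour at a; the factor
    a comes from theta T = X T'. *)
Lemma deriv_tail n e e' a b P Q r :
  CB_poly n.+1 e a b P -> CB_poly n e' a b Q ->
  e 0%N = 0%N -> (forall j, e j.+1 = (e' j).+1) -> a != 0 -> b != 0 ->
  confluent n.+1 n.+1 a a e' != 0 -> confluent n.+1 n.+1 b b e' != 0 ->
  (r <= n)%N ->
  exists2 d : R, (tail n.+1 P r.+1)^`() = d *: Q r &
    a * d * euler_at r a (Q r) = euler_at r.+1 a (P r.+1).
Proof.
move=> PB QB e0 eS a0 b0 deta detb lern.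
have lern1 : (r.+1 <= n.+1)%N by [].
have [_ _ Qab] := QB.
have [Ta Tr] := euler_at_tail_left PB lern1.
have Tb i := @euler_at_tail_right _ _ _ _ _ r.+1 i PB lern1.
have [c Tc] := tail_span r.+1 PB; set T := tail _ _ _ in Ta Tr Tb Tc *.
pose v j := if insub j.+1 is Some i then c i * (e j.+1)%:R else 0.
have T'v : T^`() = \sum_(j < n.+1) v j *: 'X^(e' j).
  rewrite Tc linear_sum big_ord_recl /= e0 derivZ derivC scaler0 add0r.
  apply: eq_bigr => j _; rewrite derivZ derivXn /v.
  have lt_j : (j.+1 < n.+2)%N by rewrite ltnS ltn_ord.
  rewrite (insubT (fun i => i < n.+2)%N lt_j) /= /bump /= add1n eS /=.
  rewrite -scaler_nat scalerA; congr (c _ * _ *: _).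
  exact: val_inj.
have [y yQ _] := CB_poly_span v QB; rewrite -T'v in yQ.
have ya := CB_poly_coord_eq0 (y := y) (r := r) QB deta.
have yb := CB_poly_coord_eq0_rev (y := y) (r := n - r) QB detb.
rewrite -yQ in ya yb.
have {}ya (k : 'I_n.+1) : (k < r)%N -> y 0 k = 0.
  apply: ya; apply: euler_at_mulX_eq0 => // i ltir.
  by rewrite -[_ * _]/(euler T) -euler_atS Ta.
have {}yb (k : 'I_n.+1) : (r < k)%N -> y 0 k = 0.
  move=> ltrk; apply: yb; last by lia.
  apply: euler_at_mulX_eq0 => // i ltir.
  by rewrite -[_ * _]/(euler T) -euler_atS Tb //; lia.
have ltrn : (r < n.+1)%N by [].
have T'E : T^`() = y 0 (Ordinal ltrn) *: Q r.
  rewrite yQ (bigD1 (Ordinal ltrn)) //= big1 ?addr0 // => k.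
  rewrite -val_eqE /= neq_ltn => /orP[ltkr|ltrk]; first by rewrite ya // scale0r.
  by rewrite yb // scale0r.
exists (y 0 (Ordinal ltrn)) => //.
rewrite -Tr euler_atS /euler euler_at_mulX T'E => [|j ltj].
  by rewrite linearZ /= mulrA.
by rewrite linearZ /= (Qab r lern).1 // mulr0.
Qed.

End PolynomialBasis.

(** * The derivative formula *)

(** The elimination that yields d_r.  The c_i are the four confluent alternants,
    the S_i their Schur values, the v_i their Vandermonde factors and D = b - a;
    t and t0 stand for theta^(r+1) B_(r+1) (a) and theta^r B'_r (a), the x_i, y_i,
    g and g' are powers of a and b, and Pi, Pi0 the products of exponents. *)
Lemma schur_ratio_identity (R : fieldType) 
    (d a t t0 c1 c2 c3 c4 S0 S1 S2 S4 x1 x2 x3 x4 y1 y2 g g' v1 v2 v3 v4 D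
     Pi Pi0 : R) :
  [/\ a != 0, c1 != 0, c3 != 0 & t0 != 0] ->
  [/\ x1 != 0, x2 != 0, x3 != 0 & x4 != 0] -> [/\ y2 != 0, g != 0 & g' != 0] ->
  [/\ v1 != 0 & v4 != 0] -> D != 0 -> Pi0 != 0 ->
  [/\ x1 * c1 = g * S0 * v1, x2 * c2 = g * S1 * v2,
      x3 * c3 = g * S2 * v3 & x4 * c4 = g' * S4 * v4] ->
  t * c1 = Pi * (y1 * c2) -> t0 * c3 = Pi0 * (y2 * c4) -> a * d * t0 = t ->
  v2 * v3 * D = v1 * v4 -> y1 * g * x1 * x4 = a * y2 * x2 * x3 * g' ->
  d = Pi / Pi0 / D * ((S1 * S2) / (S0 * S4)).
Proof.
move=> [a0 c1_0 c3_0 t0_0] [x1_0 x2_0 x3_0 x4_0] [y2_0 g_0 g'_0] [v1_0 v4_0] D0 Pi00.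
move=> [e1 e2 e3 e4] et et0 ed ev ey.
have c4_0 : c4 != 0.
  by apply: contraNneq (mulf_neq0 t0_0 c3_0) => c40; rewrite et0 c40 !mulr0.
have S0_0 : S0 != 0.
  by apply: contraNneq (mulf_neq0 x1_0 c1_0) => S00; rewrite e1 S00 mulr0 mul0r.
have S4_0 : S4 != 0.
  by apply: contraNneq (mulf_neq0 x4_0 c4_0) => S40; rewrite e4 S40 mulr0 mul0r.
have y1E : y1 = a * y2 * x2 * x3 * g' / (g * x1 * x4).
  apply: (canRL (mulfK _)); first by rewrite !mulf_neq0.
  by rewrite -ey; ring.
have v1E : v1 = v2 * v3 * D / v4 by apply: (canRL (mulfK _)).
have v23 : v2 * v3 != 0.
  by apply: contraNneq (mulf_neq0 v1_0 v4_0) => v230; rewrite -ev v230 mul0r.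
move: v23; rewrite mulf_eq0 negb_or => /andP[v2_0 v3_0].
have c1E : c1 = g * S0 * v1 / x1 by apply: (canRL (mulfK _)) => //; rewrite mulrC.
have c2E : c2 = g * S1 * v2 / x2 by apply: (canRL (mulfK _)) => //; rewrite mulrC.
have c3E : c3 = g * S2 * v3 / x3 by apply: (canRL (mulfK _)) => //; rewrite mulrC.
have c4E : c4 = g' * S4 * v4 / x4 by apply: (canRL (mulfK _)) => //; rewrite mulrC.
have S2_0 : S2 != 0.
  by apply: contraNneq (mulf_neq0 x3_0 c3_0) => S20; rewrite e3 S20 mulr0 mul0r.
have tE : t = Pi * (y1 * c2) / c1 by apply: (canRL (mulfK _)).
have t0E : t0 = Pi0 * (y2 * c4) / c3 by apply: (canRL (mulfK _)).
have -> : d = t / (a * t0).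
  by apply: (canRL (mulfK _)); rewrite ?mulf_neq0 // -ed; ring.
rewrite tE t0E c1E c2E c3E c4E v1E y1E.
by field; rewrite g_0 a0 Pi00 y2_0 S0_0 S2_0 S4_0 v2_0 v3_0 v4_0 D0 x1_0 x2_0
  x3_0 x4_0 g'_0.
Qed.

Section DerivativeFormula.
Variable R : realType.

(** The functions of the statement are only controlled on the positive half
    line; polynomials are determined there. *)
Lemma poly_pos_eq (p q : {poly R}) : (forall t, 0 < t -> p.[t] = q.[t]) -> p = q.
Proof.
move=> pq; apply/eqP; rewrite -subr_eq0; apply/eqP.
pose rs : seq R := [seq i.+1%:R | i <- iota 0 (size (p - q))].
apply: (@roots_geq_poly_eq0 _ _ rs).
- apply/allP => _ /mapP[i _ ->].
  by rewrite rootE hornerD hornerN pq ?subrr // ltr0Sn.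
- rewrite map_inj_uniq ?iota_uniq // => i j /eqP.
  by rewrite eqr_nat => /eqP[].
- by rewrite size_map size_iota.
Qed.

Lemma derive1n_pos_poly (f : R -> R) (p : {poly R}) j :
  (forall t, 0 < t -> f t = p.[t]) -> forall t, 0 < t -> derive1n j f t = p^`(j).[t].
Proof.
move=> fp; elim: j => [|j IH] t t0; first exact: fp.
rewrite derive1nS derive1E derivnS (@near_eq_derive _ _ _ _ (horner p^`(j))).
  exact: derive_val.
by near=> u; apply: IH; near: u; exact: lt_nbhsr.
Unshelve. all: by end_near. Qed.

Lemma vanishes_euler_at (f : R -> R) (p : {poly R}) x k :
  (forall t, 0 < t -> f t = p.[t]) -> 0 < x -> vanishes f x k ->
  forall i, (i < k)%N -> euler_at i x p = 0.
Proof.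
move=> fp x0 fk; apply: euler_at_derivn => j ltjk.
by rewrite -(derive1n_pos_poly j fp x0) fk.
Qed.

Lemma CB_basis_poly n la a b (B : nat -> R -> R) :
  0 < a -> 0 < b -> is_CB_basis n la a b B ->
  exists2 P : nat -> {poly R}, CB_poly n (muntz_exp la) a b P &
    forall k t, (k <= n)%N -> 0 < t -> B k t = (P k).[t].
Proof.
move=> a0 b0 [[BE _ Bfree] B1 Bab].
have /choice[c cB] (k : 'I_n.+1) : exists c : 'I_n.+1 -> R, forall t, 0 < t ->
    B k t = \sum_(i < n.+1) c i * t ^+ muntz_exp la i.
  by apply: BE; rewrite -ltnS.
pose C := \matrix_(k < n.+1, j < n.+1) c k j.
pose P k := \sum_(j < n.+1) C (inord k) j *: 'X^(muntz_exp la j).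
have PE (k : 'I_n.+1) : P k = \sum_(j < n.+1) C k j *: 'X^(muntz_exp la j).
  by rewrite /P inord_val.
have BP k t : (k <= n)%N -> 0 < t -> B k t = (P k).[t].
  rewrite -ltnS => lekn t0; rewrite (cB (Ordinal lekn)) // (PE (Ordinal lekn)).
  by rewrite horner_sum; apply: eq_bigr => j _; rewrite hornerZ hornerXn mxE.
exists P => //; split.
- exists C => //; rewrite unitmxE unitfE; apply/det0P => -[v v0 vC].
  case/negP: v0; apply/eqP/rowP => i; rewrite mxE; apply: (Bfree (v 0)) => t t0.
  under eq_bigr => k _ do rewrite cB // mulr_sumr.
  rewrite exchange_big /= big1 // => j _.
  have /rowP/(_ j) := vC; rewrite !mxE => vCj.
  transitivity ((\sum_k v 0 k * C k j) * t ^+ muntz_exp la j).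
    by rewrite mulr_suml; apply: eq_bigr => k _; rewrite mxE mulrA.
  by rewrite vCj mul0r.
- apply: poly_pos_eq => t t0; rewrite horner_sum hornerC -[RHS](B1 t t0).
  by apply: eq_bigr => k _; rewrite BP // -ltnS.
- move=> k lekn; have [Ba Bb] := Bab k lekn.
  by split; apply: (@vanishes_euler_at (B k)) => // t t0; apply: BP.
Qed.

Lemma confluent_muntz_split la m r s n (a b : R) : is_partition n la ->
  (r + s)%N = m -> (0 < m)%N -> a != 0 -> b != 0 ->
  b ^+ (r * nth 0 la 0)%N * a ^+ (s * nth 0 la 0)%N *
    confluent m r a b (muntz_exp la) =
  (a * b) ^+ (\sum_(j < m) (nth 0 la 0 - nth 0 la j))%N *
    schur2 la a s b r * confluent_vandermonde m r a b.
Proof.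
move=> part <- m_gt0 a0 b0.
by rewrite -prod_node addnC -(confluent_muntz part) // addnC.
Qed.

Lemma confluent_vandermonde_neq0 m r (a b : R) : a != 0 -> b != 0 -> b != a ->
  confluent_vandermonde m r a b != 0.
Proof.
move=> a0 b0 ab; apply/prodf_neq0 => i _; apply: mulf_neq0; first apply: mulf_neq0.
- by rewrite pnatr_eq0 -lt0n fact_gt0.
- by rewrite expf_neq0 // /node; case: ifP.
- by case: ifP; rewrite ?oner_eq0 // expf_neq0 // subr_eq0.
Qed.

(** Here r + s = n - 1.  The alternants have r + 1 and s + 1 points for the
    partition, r + 1 and s, then r and s + 1, for its bottom partition, and r
    and s for the second bottom partition. *)
Lemma deriv_tail_coef r s la a b (P Q : nat -> {poly R}) (d : R) :
  let n := (r + s).+1 in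
  (0 < r + s)%N -> is_partition n la -> nth 0%N la 0 = nth 0%N la 1 ->
  0 < a -> a < b ->
  CB_poly n (muntz_exp la) a b P -> CB_poly (r + s) (muntz_exp (behead la)) a b Q ->
  a * d * euler_at r a (Q r) = euler_at r.+1 a (P r.+1) ->
  d = n%:R / ((b - a) * gbinom R la n) * Rfactor la a b r n.
Proof.
move=> n rs_gt0 part l12 a_gt0 ltab PB QB dE; rewrite /n in part PB *.
have a0 : a != 0 by rewrite gt_eqF.
have b0 : b != 0 by rewrite gt_eqF // (lt_trans a_gt0).
have ba : b != a by rewrite gt_eqF.
have part0 := behead_partition part.
have part1 : is_partition (r + s) (behead (behead la)).
  by apply: behead_partition; exact: partitionW part0.
set la0 := behead la in QB part0 part1 *; set la1 := behead la0 in part1 *.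
have deta := confluent_one_point_neq0 (r + s).+2 part a0.
have detb := confluent_one_point_neq0 (r + s).+2 part b0.
have deta0 := confluent_one_point_neq0 (r + s).+1 part0 a0.
have detb0 := confluent_one_point_neq0 (r + s).+1 part0 b0.
have lern : (r.+1 <= (r + s).+1)%N by rewrite ltnS leq_addr.
have tau := euler_at_CB_poly PB (muntz_exp0 la) lern.
have tau0 := euler_at_CB_poly QB (muntz_exp0 la0) (leq_addr s r).
rewrite (confluent_muntzS _ _ part lern) in tau.
rewrite (confluent_muntzS _ _ part0 (leq_addr s r)) in tau0.
have prodS g : \prod_(i < (r + s).+1) node r.+1 a b i ^+ g =
  a ^+ (r.+1 * g) * b ^+ (s * g) := prod_node r.+1 s a b g.
rewrite prodS in tau.
rewrite prod_node in tau0.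
have D1 := @confluent_muntz_split la (r + s).+2 r.+1 s.+1 _ a b part _ _ a0 b0.
have D2 := @confluent_muntz_split la0 (r + s).+1 r.+1 s _ a b part0 _ _ a0 b0.
have D3 := @confluent_muntz_split la0 (r + s).+1 r s.+1 _ a b part0 _ _ a0 b0.
have D4 := @confluent_muntz_split la1 (r + s) r s _ a b part1 _ rs_gt0 a0 b0.
have {}D1 := D1 ltac:(by rewrite addSn addnS) isT.
have {}D2 := D2 (addSn _ _) isT.
have {}D3 := D3 (addnS _ _) isT.
have {}D4 := D4 erefl.
rewrite /Rfactor /bottom_partition -/la0 -/la1.
rewrite (_ : (r + s).+1 - r - 1 = s)%N; last by lia.
rewrite (_ : (r + s).+1 - r = s.+1)%N; last by lia.
have -> : (r + s).+1%:R / ((b - a) * gbinom R la (r + s).+1) =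
    \prod_(j < (r + s).+1) (muntz_exp la j.+1)%:R /
    \prod_(j < r + s) (muntz_exp la0 j.+1)%:R / (b - a).
  by rewrite -gbinomE // invfM; ring.
have lam0 : nth 0%N la0 0 = nth 0%N la 0 by rewrite nth_behead -l12.
have le32 : (nth 0 la1 0 <= nth 0 la 0)%N.
  by rewrite !nth_behead; exact: nth_partition part _.
set l := nth 0%N la 0 in le32 lam0 *; pose mu := (l - nth 0 la1 0)%N.
have lam1 : nth 0%N la0 1 = nth 0%N la1 0 by rewrite !nth_behead.
rewrite -l12 subnn lam0 in tau D2 D3.
rewrite lam0 lam1 -/mu in tau0.
set sg := (\sum_(j < (r + s).+1) (l - nth 0 la0 j))%N in D2 D3.
have sgE : (\sum_(j < (r + s).+2) (l - nth 0 la j))%N = sg.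
  rewrite big_ord_recl /= -/l subnn add0n; apply: eq_bigr => j _.
  by rewrite nth_behead.
rewrite -/l sgE in D1.
set sg' := (\sum_(j < r + s) _)%N in D4.
have sg'E : sg = (sg' + (r + s) * mu)%N.
  rewrite /sg big_ord_recl /= lam0 subnn add0n.
  rewrite -[X in (X * mu)%N]card_ord -sum_nat_const -big_split /=.
  apply: eq_bigr => j _; rewrite -nth_behead -/la1 /mu.
  by have := nth_partition part1 (leq0n j); lia.
have lt0 := CB_poly_diag_neq0 QB deta0 (leq_addr s r).
(* With l = lambda_2 and mu = l - lambda_3, what remains is a count of the
   exponents of a and of b. *)
have lE : l = (mu + nth 0 la1 0)%N by rewrite /mu subnK.
have ne_ab i j : a ^+ i * b ^+ j != 0 by rewrite mulf_neq0 ?expf_neq0.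
have V0 m k := @confluent_vandermonde_neq0 m k _ _ a0 b0 ba.
apply: (schur_ratio_identity _ _ _ _ _ _ (And4 D1 D2 D3 D4) tau tau0 dE).
- split=> //; first exact: CB_poly_confluent_neq0 PB deta detb (leqW lern).
  by apply: CB_poly_confluent_neq0 QB deta0 detb0 _; lia.
- by split; rewrite mulrC ne_ab.
- by split; rewrite ?ne_ab ?expf_neq0 ?mulf_neq0.
- by [].
- by rewrite subr_eq0.
- by apply/prodf_neq0 => j _; exact: muntz_expS_neq0 part0.
- exact: confluent_vandermonde_rec.
set l3 := nth 0%N la1 0 in lE *.
transitivity (a ^+ (r.+1 * 1 + sg + s.+1 * l + s * l3) *
              b ^+ (s * 1 + sg + r.+1 * l + r * l3)).
  by rewrite !exprD !exprMn; ring.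
transitivity (a ^+ (1 + r * mu.+1 + s * l + s.+1 * l + sg') *
              b ^+ (s * mu.+1 + r.+1 * l + r * l + sg')); last first.
  by rewrite !exprD !exprMn; ring.
by rewrite sg'E lE; congr (_ ^+ _ * _ ^+ _); lia.
Qed.

End DerivativeFormula.

Theorem theorem9 (R : realType) (n : nat) (la : seq nat) (a b : R)
    (B B' : nat -> R -> R) :
  (2 <= n)%N ->
  is_partition n la ->
  nth 0%N la 0 = nth 0%N la 1 ->
  0 < a -> a < b ->
  is_CB_basis n la a b B ->
  is_CB_basis n.-1 (bottom_partition la) a b B' ->
  forall k : nat, (k <= n)%N -> forall t : R, 0 < t ->
    is_derive t (1 : R) (B k)
      (n%:R / ((b - a) * gbinom R la n) *
        ((if k == 0%N then 0 else Rfactor la a b k.-1 n * B' k.-1 t)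
         - (if k == n then 0 else Rfactor la a b k n * B' k t))).
Proof.
case: n => // n; rewrite /bottom_partition /= ltnS => n_gt0 part l12 a_gt0 ltab.
have b_gt0 := lt_trans a_gt0 ltab.
have part0 := behead_partition part.
have a0 : a != 0 by rewrite gt_eqF.
have b0 : b != 0 by rewrite gt_eqF.
move=> /(CB_basis_poly a_gt0 b_gt0)[P PB BP] /(CB_basis_poly a_gt0 b_gt0)[Q QB B'Q].
move=> k lekn t t_gt0.
have dtail r : (r <= n)%N -> (tail n.+1 P r.+1)^`() =
    (n.+1%:R / ((b - a) * gbinom R la n.+1) * Rfactor la a b r n.+1) *: Q r.
  move=> lern.
  have eS j : muntz_exp la j.+1 = (muntz_exp (behead la) j).+1.
    by rewrite (muntz_expS _ part) -l12 subnn addn1.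
  have deta := confluent_one_point_neq0 n.+1 part0 a0.
  have detb := confluent_one_point_neq0 n.+1 part0 b0.
  have [d -> dE] := deriv_tail PB QB (muntz_exp0 la) eS a0 b0 deta detb lern.
  congr (_ *: _).
  move: PB QB part dE n_gt0; rewrite -(subnKC lern) => PB QB part dE n_gt0.
  exact: deriv_tail_coef n_gt0 part l12 a_gt0 ltab PB QB dE.
have Pk : (P k)^`() = (n.+1%:R / ((b - a) * gbinom R la n.+1)) *:
    ((if k == 0%N then 0 else Rfactor la a b k.-1 n.+1 *: Q k.-1)
     - (if k == n.+1 then 0 else Rfactor la a b k n.+1 *: Q k)).
  rewrite (tailS P lekn) derivB scalerBr; congr (_ - _).
    case: k lekn => [|k] lekn /=; last by rewrite dtail // scalerA.
    have [_ P1 _] := PB.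
    by rewrite /tail big_mkord P1 scaler0 -[1]/(1%:P) derivC.
  case: eqP => [->|/eqP neq_kn]; first by rewrite /tail big_geq // scaler0 deriv0.
  by rewrite dtail ?scalerA // -ltnS ltn_neqAle neq_kn.
apply: (@near_eq_is_derive _ _ _ (horner (P k))).
  by near=> u; rewrite BP //; near: u; exact: lt_nbhsr.
apply: trigger_derive.
rewrite Pk hornerZ hornerD hornerN; congr (_ * (_ - _)).
  case: k lekn {Pk} => [|k] lekn /=; first by rewrite hornerC.
  by rewrite hornerZ -B'Q.
case: eqP => [_|/eqP neq_kn]; first by rewrite hornerC.
by rewrite hornerZ -B'Q // -ltnS ltn_neqAle neq_kn.
Unshelve. all: by end_near. Qed.
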